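(* Let $F$ be a graph with chromatic number $\chi(F)\geq 3$ and suppose $\pi_q(F)>1$. Then $\pi_q(F)=2\pi(F)$.
   Context: All graphs are finite and simple. For a graph $G$, $Q(G)=D(G)+A(G)$ is its signless Laplacian matrix ($D(G)$ the diagonal degree matrix, $A(G)$ the adjacency matrix) and $q(G)$ is the largest eigenvalue of $Q(G)$. A graph is $F$-free if it contains no subgraph isomorphic to $F$. $\mathrm{ex}(n,F)$ is the maximum number of edges of an $n$-vertex $F$-free graph, and $\pi(F)=\lim_{n\to\infty}\mathrm{ex}(n,F)/\binom{n}{2}$ is the Turán density. $\mathrm{ex}_q(n,F)=\max\{q(G): G \text{ has } n \text{ vertices and is } F\text{-free}\}$, and $\pi_q(F)=\lim_{n\to\infty}\mathrm{ex}_q(n,F)/n$ (this limit exists when $\chi(F)\ge 3$). *)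

(* Defs.v *)
From HB Require Import structures.
From mathcomp Require Import all_boot all_order all_algebra.
From mathcomp Require Import all_classical all_reals all_analysis.
Import Order.TTheory GRing.Theory Num.Theory.
Import numFieldNormedType.Exports.

Set Implicit Arguments.
Unset Strict Implicit.
Unset Printing Implicit Defensive.

Record sgraph (V : finType) := SGraph {
  edges : {set {set V}};
  _ : [forall e in edges, #|e| == 2]
}.

HB.instance Definition _ (V : finType) := [isSub for @edges V].
HB.instance Definition _ (V : finType) := [Finite of sgraph V by <:].

Definition adj (V : finType) (G : sgraph V) : rel V :=
  fun x y => [set x; y]%SET \in edges G.

Lemma adj_sym (V : finType) (G : sgraph V) : symmetric (adj G).
Proof. by move=> x y; rewrite /adj finset.setUC. Qed.

Lemma adj_irrefl (V : finType) (G : sgraph V) : irreflexive (adj G).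
Proof.
move=> x; apply/negP; rewrite /adj => Gxx.
by have /forall_inP/(_ _ Gxx) := valP G; rewrite cards2 eqxx.
Qed.

Definition deg (V : finType) (G : sgraph V) (x : V) : nat := #|adj G x|.

Definition colorable (V : finType) (G : sgraph V) (k : nat) : bool :=
  [exists c : {ffun V -> 'I_k},
    [forall x, forall y, adj G x y ==> (c x != c y)]].

Lemma colorable_card (V : finType) (G : sgraph V) :
  exists k, colorable G k.
Proof.
exists #|V|; apply/existsP; exists [ffun x => enum_rank x].
apply/forallP => x; apply/forallP => y; apply/implyP; rewrite !ffunE.
by apply: contraTneq => /enum_rank_inj ->; rewrite adj_irrefl.
Qed.

Definition chi (V : finType) (G : sgraph V) : nat := ex_minn (colorable_card G).

(* G has a subgraph isomorphic to F, not necessarily an induced one: the image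
   of F under the injection f. *)
Definition contains (U V : finType) (F : sgraph U) (G : sgraph V) : bool :=
  [exists f : {ffun U -> V},
    injectiveb f && [forall x, forall y, adj F x y ==> adj G (f x) (f y)]].

Definition free_of (U V : finType) (F : sgraph U) (G : sgraph V) : bool :=
  ~~ contains F G.

Definition ex_edges (U : finType) (F : sgraph U) (n : nat) : nat :=
  \max_(G : sgraph 'I_n | free_of F G) #|edges G|.

Local Open Scope classical_set_scope.
Local Open Scope ring_scope.

(* The terms n = 0, 1, where the denominator vanishes, do not matter to the
   limit. *)
Definition turan_density (R : realType) (U : finType) (F : sgraph U) : R :=
  limn (fun n => (ex_edges F n)%:R / 'C(n, 2)%:R : R).

Definition adjacency_mx (R : realType) (n : nat) (G : sgraph 'I_n) : 'M[R]_n :=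
  \matrix_(i, j) (adj G i j)%:R.

Definition degree_mx (R : realType) (n : nat) (G : sgraph 'I_n) : 'M[R]_n :=
  diag_mx (\row_i (deg G i)%:R).

Definition signless_laplacian (R : realType) (n : nat) (G : sgraph 'I_n) :
    'M[R]_n :=
  degree_mx R G + adjacency_mx R G.

(* Q(G) is a real symmetric matrix, so for n > 0 its real eigenvalues form a
   nonempty finite set and the supremum is their maximum. *)
Definition max_q_eigenvalue (R : realType) (n : nat) (G : sgraph 'I_n) : R :=
  sup [set a : R | eigenvalue (signless_laplacian R G) a].

(* A maximum as well: there are finitely many graphs on 'I_n, and the edgeless
   one is F-free as soon as F has an edge. *)
Definition ex_q (R : realType) (U : finType) (F : sgraph U) (n : nat) : R :=
  sup [set max_q_eigenvalue R G | G in [set G : sgraph 'I_n | free_of F G]].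

Definition q_density (R : realType) (U : finType) (F : sgraph U) : R :=
  limn (fun n => ex_q R F n / n%:R : R).

(* Main.v *)
Require Import Defs.
From HB Require Import structures.
From mathcomp Require Import all_boot all_order all_algebra.
From mathcomp Require Import all_classical all_reals all_analysis.
From mathcomp Require Import ring lra.
Import Order.TTheory GRing.Theory Num.Theory.
Import numFieldNormedType.Exports.
Local Open Scope ring_scope.

(** Write [q(G)] as the maximum of the form [\sum_(ij in E) (x_i + x_j)^2] on
    the unit sphere, attained at a nonnegative eigenvector [x].  The constant
    vector gives [4 m / n <= q(G)], hence [2 pi <= pi_q].  For the converse,
    fix [e > 0] and an F-free graph [G] on [n] vertices.  If every [x_i ^ 2] is
    at least [(1 - e) / n], then [q(G) <= 2 \sum_i d_i x_i ^ 2] is at most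
    [4 m / n + 2 n e].  Otherwise delete the vertex [k] with the smallest
    entry; with [t = x_k ^ 2],
    [q(G - k) (1 - t) >= q(G) (1 - 2 t) - 1 + n t].
    If the second case occurred for all large [n], then, since [pi_q > 1],
    [r_n = ex_q(n) / (n - 1)] would decrease by at least a constant multiple of
    [1 / n] at every step, and the harmonic series would contradict the
    convergence of [r_n].  So the first case occurs for arbitrarily large [n],
    and the limits satisfy [pi_q <= 2 pi + 2 e]. *)

(** * Quadratic forms and compactness of the unit sphere *)

Section SymmetricMatrices.

Local Open Scope classical_set_scope.

Context {R : realType} {n : nat}.
Implicit Types (M : 'M[R]_n) (x y : 'rV[R]_n).

Definition qform M x : R := (x *m M *m x^T) 0 0.

Definition sqnorm x : R := \sum_i x 0 i ^+ 2.

Lemma qformE M x : qform M x = \sum_i \sum_j x 0 i * M i j * x 0 j.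
Proof.
rewrite /qform mxE exchange_big /=; apply: eq_bigr => j _.
by rewrite !mxE mulr_suml; apply: eq_bigr => i _.
Qed.

Lemma sqnormE x : sqnorm x = (x *m x^T) 0 0.
Proof. by rewrite mxE; apply: eq_bigr => i _; rewrite mxE expr2. Qed.

Lemma sqnorm_ge0 x : 0 <= sqnorm x.
Proof. by apply: sumr_ge0 => i _; rewrite sqr_ge0. Qed.

Lemma sqnorm_eq0 x : (sqnorm x == 0) = (x == 0).
Proof.
apply/eqP/eqP => [x0|->]; last by rewrite sqnormE mul0mx mxE.
apply/rowP => i; rewrite mxE; apply/eqP; rewrite -sqrf_eq0.
by move/psumr_eq0P: x0 => -> // j _; rewrite sqr_ge0.
Qed.

Lemma sqnormZ a x : sqnorm (a *: x) = a ^+ 2 * sqnorm x.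
Proof.
by rewrite /sqnorm mulr_sumr; apply: eq_bigr => i _; rewrite mxE exprMn.
Qed.

Lemma qformZ M a x : qform M (a *: x) = a ^+ 2 * qform M x.
Proof. by rewrite /qform linearZ /= -!scalemxAl -scalemxAr !mxE mulrA expr2. Qed.

Lemma qform_eigen M a x : x *m M = a *: x -> qform M x = a * sqnorm x.
Proof. by move=> xM; rewrite /qform xM -scalemxAl mxE sqnormE. Qed.

(* Expanding [0 <= qform N (x - s *: (x *m N))] leaves
   [2 * sqnorm (x *m N) <= s * qform N (x *m N)] for every [s > 0]. *)
Lemma psd_qform_eq0 (N : 'M[R]_n) x :
  N^T = N -> (forall y, 0 <= qform N y) -> qform N x = 0 -> x *m N = 0.
Proof.
move=> Nsym Npos x0; set y := x *m N.
have yx : (y *m N *m x^T) 0 0 = sqnorm y.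
  by rewrite sqnormE -mulmxA [y^T]trmx_mul Nsym.
have expand s : qform N (x - s *: y) = s ^+ 2 * qform N y - 2 * s * sqnorm y.
  have tr : (x - s *: y)^T = x^T - s *: y^T by rewrite linearB linearZ.
  rewrite /qform tr !(mulmxBl, mulmxBr) -!(scalemxAl, scalemxAr).
  have mxB (A B : 'M[R]_1) : (A - B) 0 0 = A 0 0 - B 0 0 by rewrite !mxE.
  have mxZ a (A : 'M[R]_1) : (a *: A) 0 0 = a * A 0 0 by rewrite mxE.
  move: x0; rewrite /qform !(mxB, mxZ) -/y yx -sqnormE => ->; ring.
apply/eqP; rewrite -sqnorm_eq0; apply/negPn/negP => y0.
have yp : 0 < sqnorm y by rewrite lt_def y0 sqnorm_ge0.
have gy := Npos y; have dp : 0 < qform N y + 1 by lra.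
(* With this step size [s] the expansion equals [- s ^+ 2 * (qform N y + 2)], which is negative. The
   [+ 1] keeps the denominator positive even if [qform N y] is zero. *)
have := Npos (x - (sqnorm y / (qform N y + 1)) *: y); rewrite expand.
set s := sqnorm y / _; have sp : 0 < s by apply: divr_gt0.
have sE : s * (qform N y + 1) = sqnorm y by rewrite /s divfK ?gt_eqF.
rewrite -sE; nra.
Qed.

Lemma sqnorm_coord_le x i : x 0 i ^+ 2 <= sqnorm x.
Proof.
rewrite /sqnorm (bigD1 i) //= lerDl; apply: sumr_ge0 => j _.
by rewrite sqr_ge0.
Qed.

Lemma continuous_sqnorm : continuous sqnorm.
Proof.
apply: continuous_big => [|i _ x]; first exact: add_continuous.
have cx := @coord_continuous R 1 n 0 i x. exact: (cvgM cx cx).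
Qed.

Lemma continuous_qform M : continuous (qform M).
Proof.
have -> : qform M = fun x => \sum_i \sum_j x 0 i * M i j * x 0 j.
  by apply/funext => x; exact: qformE.
apply: continuous_big => [|i _]; first exact: add_continuous.
apply: continuous_big => [|j _ x]; first exact: add_continuous.
have c k := @coord_continuous R 1 n 0 k x.
exact: (cvgM (cvgM (c i) (cvg_cst (M i j))) (c j)).
Qed.

Lemma compact_sphere : compact [set x | sqnorm x = 1].
Proof.
apply: bounded_closed_compact.
  exists 1; split; first exact: num_real.
  move=> r r1 x /= x1; rewrite /Num.norm /= mx_normrE.
  apply: bigmax_le => [|[i j] _ /=]; first by lra.
  rewrite (ord1 i); apply: le_trans (ltW r1).
  rewrite -[leRHS]ger0_norm // -ler_sqr ?nnegrE // !real_normK ?num_real //.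
  by rewrite expr1n -x1; exact: sqnorm_coord_le.
apply: (@closed_comp _ _ sqnorm [set 1 : R]) => [x _|]; last exact: closed_eq.
exact: continuous_sqnorm.
Qed.

End SymmetricMatrices.

(** * Nonnegative top eigenvectors of symmetric nonnegative matrices *)

Section PerronFrobenius.

Local Open Scope classical_set_scope.

Context {R : realType} {n : nat}.
Implicit Types (M : 'M[R]_n.+1) (x y : 'rV[R]_n.+1).

(** The maximum on the unit sphere exists by compactness; both sides scale by the square of the
    factor, which carries the bound to every [y]. *)
Lemma qform_attains_max M :
  exists2 x, sqnorm x = 1 & forall y, qform M y <= qform M x * sqnorm y.
Proof.
have ex1 : [set x : 'rV[R]_n.+1 | sqnorm x = 1] !=set0.
  exists (delta_mx 0 ord0) => /=; rewrite /sqnorm (bigD1 ord0) //=.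
  rewrite !mxE !eqxx expr1n big1 ?addr0 // => i i0.
  by rewrite mxE (negbTE i0) andbF expr0n.
have qc : {within [set x | sqnorm x = 1], continuous (qform M)}.
  by apply: continuous_subspaceT; exact: continuous_qform.
have [x] := compact_EVT_max ex1 compact_sphere qc.
rewrite inE /= => x1 xmax; exists x => // y.
have [->|y0] := eqVneq y 0.
  by rewrite -(scale0r (0 : 'rV_n.+1)) qformZ sqnormZ expr0n !mul0r mulr0.
have yp : 0 < sqnorm y by rewrite lt_def sqnorm_eq0 y0 sqnorm_ge0.
have := xmax ((Num.sqrt (sqnorm y))^-1 *: y).
rewrite inE /= sqnormZ qformZ exprVn sqr_sqrtr ?sqnorm_ge0 // mulVf ?gt_eqF //.
by move/(_ erefl); rewrite mulrC ler_pdivrMr.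
Qed.

(** As the entries of [M] are nonnegative, replacing a maximiser [u] by its entrywise absolute value
    [x] does not decrease the form, so [x] is a maximiser too. With [l] the maximum, [l%:M - M] is
    positive semidefinite and its form vanishes at [x], which makes [x] an eigenvector. Testing
    maximality on the other eigenvectors gives [q = l]. *)
Lemma perron_frobenius_sym M : M^T = M -> (forall i j, 0 <= M i j) ->
  let q := sup [set a | eigenvalue M a] in
  exists x, [/\ forall i, 0 <= x 0 i, sqnorm x = 1, x *m M = q *: x
    & forall y, qform M y <= q * sqnorm y].
Proof.
move=> Msym Mpos q; have [u u1 umax] := qform_attains_max M.
pose x : 'rV[R]_n.+1 := \row_i `|u 0 i|.
have x1 : sqnorm x = 1.
  by rewrite -u1; apply: eq_bigr => i _; rewrite mxE real_normK ?num_real.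
have xu : qform M x = qform M u.
  apply/le_anti; rewrite -[qform M u]mulr1 -{1}x1 umax /= mulr1 !qformE.
  apply: ler_sum => i _; apply: ler_sum => j _; rewrite !mxE.
  rewrite (le_trans (ler_norm _)) // !normrM.
  by rewrite (ger0_norm (Mpos i j)).
set l := qform M u in umax xu *.
have xl : x *m M = l *: x.
  have lE y : qform (l%:M - M) y = l * sqnorm y - qform M y.
    rewrite /qform mulmxBr mulmxBl mul_mx_scalar -scalemxAl 3!mxE.
    by rewrite sqnormE [in RHS]mxE mxE.
  have : x *m (l%:M - M) = 0.
    apply: psd_qform_eq0 => [|y|].
    - by rewrite linearB /= tr_scalar_mx Msym.
    - by rewrite lE subr_ge0.
    - by rewrite lE x1 xu mulr1 subrr.
  by rewrite mulmxBr mul_mx_scalar => /eqP; rewrite subr_eq0 => /eqP.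
have x0 : x != 0 by rewrite -sqnorm_eq0 x1 oner_eq0.
have lev : eigenvalue M l by apply/eigenvalueP; exists x.
have lub a : eigenvalue M a -> a <= l.
  move=> /eigenvalueP[v va v0]; have := umax v; rewrite (qform_eigen _ _ _ va).
  by rewrite ler_pM2r // lt_def sqnorm_eq0 v0 sqnorm_ge0.
suff -> : q = l by exists x; split => // i; rewrite mxE.
apply/le_anti/andP; split; first by apply: ge_sup; [exists l|].
by apply: ub_le_sup => //; exists l.
Qed.

End PerronFrobenius.

(** * Degrees, edge counts and vertex deletion *)

Section Graphs.

Context {U V W : finType}.

Lemma card_edge {G : sgraph V} e : e \in edges G -> #|e| = 2%N.
Proof. by move=> eG; have /forall_inP/(_ e eG)/eqP := valP G. Qed.

Lemma degE (G : sgraph V) x : deg G x = (\sum_y adj G x y)%N.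
Proof. by rewrite /deg -sum1_card big_mkcond; apply: eq_bigr. Qed.

Lemma deg_card_edges (G : sgraph V) x :
  deg G x = #|[set e in edges G | x \in e]|.
Proof.
rewrite /deg -(@card_in_imset _ _ (fun y => [set x; y]%SET)); last first.
  move=> y z /= xy xz eqyz; have : y \in [set x; z]%SET.
    by rewrite -eqyz finset.in_setU !finset.in_set1 eqxx orbT.
  rewrite !finset.inE => /orP[/eqP yx|/eqP //].
  by move: xy; rewrite yx -topredE /= adj_irrefl.
congr #|pred_of_set _|; apply/setP => e; rewrite !finset.inE.
apply/imsetP/andP => [[y xy ->]|[eG xe]].
  by rewrite !finset.inE eqxx.
have /eqP/cards2P[a [b [ab eab]]] := card_edge e eG.
move: xe; rewrite eab !finset.inE => /orP[]/eqP xE; subst x.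
  by exists b => //; rewrite -topredE /= /adj -eab.
by exists a; [rewrite -topredE /= adj_sym /adj -eab|rewrite finset.setUC].
Qed.

Lemma sum_deg (G : sgraph V) : (\sum_x deg G x = 2 * #|edges G|)%N.
Proof.
transitivity (\sum_x \sum_(e in edges G) (x \in e))%N.
  apply: eq_bigr => x _; rewrite deg_card_edges -sum1_card.
  rewrite big_mkcond [RHS]big_mkcond /=; apply: eq_bigr => e _.
  by rewrite finset.inE; case: (e \in _); case: (x \in e).
rewrite exchange_big /= mulnC -sum_nat_const; apply: eq_bigr => e eG.
by rewrite -(card_edge e eG) -sum1_card [RHS]big_mkcond; apply: eq_bigr.
Qed.

Lemma pullback_subproof (f : W -> V) (f_inj : injective f) (G : sgraph V) :
  [forall e in [set e : {set W} | f @: e \in edges G], #|e| == 2].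
Proof.
apply/forall_inP => e; rewrite finset.inE => /card_edge.
by rewrite card_imset // => ->.
Qed.

Definition pullback (f : W -> V) (f_inj : injective f) (G : sgraph V) :
  sgraph W := SGraph (pullback_subproof f f_inj G).

Lemma adj_pullback (f : W -> V) (f_inj : injective f) (G : sgraph V) x y :
  adj (pullback f f_inj G) x y = adj G (f x) (f y).
Proof. by rewrite /adj finset.inE imsetU1 imset_set1. Qed.

Lemma free_of_pullback (f : W -> V) (f_inj : injective f) (F : sgraph U)
    (G : sgraph V) :
  free_of F G -> free_of F (pullback f f_inj G).
Proof.
apply: contra => /existsP[g /andP[/injectiveP g_inj /forallP gF]].
apply/existsP; exists [ffun u => f (g u)]; apply/andP; split.
  by apply/injectiveP => u v; rewrite !ffunE => /f_inj/g_inj.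
apply/forallP => u; apply/forallP => v; rewrite !ffunE.
by have /forallP/(_ v) := gF u; rewrite adj_pullback.
Qed.

End Graphs.

(** Relabelling through [lift k] keeps the vertex set of the form ['I_n], so the extremal quantities
    at [n] apply to the result. *)
Definition del_vertex {n} (G : sgraph 'I_n.+1) (k : 'I_n.+1) : sgraph 'I_n :=
  pullback (lift k) lift_inj G.

Lemma adj_del_vertex n (G : sgraph 'I_n.+1) k i j :
  adj (del_vertex G k) i j = adj G (lift k i) (lift k j).
Proof. exact: adj_pullback. Qed.

(** Doubled, both sides become degree sums: deleting [k] removes the term [deg G k] and lowers the
    degree of each neighbour of [k] by one. *)
Lemma card_edges_del_vertex n (G : sgraph 'I_n.+1) k :
  #|edges G| = (#|edges (del_vertex G k)| + deg G k)%N.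
Proof.
apply/eqP; rewrite -(eqn_pmul2l (isT : 0 < 2)%N) mulnDr -!sum_deg.
rewrite (bigD1_ord k) //= mul2n -addnn addnA addnC eqn_add2r; apply/eqP.
transitivity (\sum_(i < n) (adj G (lift k i) k + deg (del_vertex G k) i))%N.
  apply: eq_bigr => i _; rewrite !degE (bigD1_ord k) //=; congr addn.
  by apply: eq_bigr => j _; rewrite adj_del_vertex.
rewrite big_split /= addnC; congr addn.
rewrite degE (bigD1_ord k) //= adj_irrefl add0n.
by apply: eq_bigr => i _; rewrite adj_sym.
Qed.

Lemma card_edges_le_ex (U : finType) (F : sgraph U) n (G : sgraph 'I_n) :
  free_of F G -> (#|edges G| <= ex_edges F n)%N.
Proof. exact: leq_bigmax_cond. Qed.

(* Averaging the number of edges over all vertex-deleted subgraphs. *)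
Lemma ex_edges_averaging (U : finType) (F : sgraph U) n :
  (ex_edges F n.+3 * n.+1 <= ex_edges F n.+2 * n.+3)%N.
Proof.
rewrite -leq_divRL //; apply/bigmax_leqP => G FG; rewrite leq_divRL //.
have : (\sum_(k < n.+3) #|edges G| <=
        \sum_(k < n.+3) (ex_edges F n.+2 + deg G k))%N.
  apply: leq_sum => k _; rewrite (card_edges_del_vertex _ _ k) leq_add2r.
  exact/card_edges_le_ex/free_of_pullback.
rewrite big_split /= !sum_nat_const card_ord sum_deg.
move: #|edges G| => m.
by rewrite -{1}(addn2 n.+1) mulnDl leq_add2r mulnC [X in (_ <= X)%N]mulnC.
Qed.

(** * Eigenvalue bounds for the signless Laplacian *)

Section SignlessLaplacian.

Context {R : realType}.

Lemma sum_adj n (G : sgraph 'I_n) i :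
  \sum_j (adj G i j)%:R = (deg G i)%:R :> R.
Proof. by rewrite degE natr_sum. Qed.

Lemma signless_laplacian_tr n (G : sgraph 'I_n) :
  (signless_laplacian R G)^T = signless_laplacian R G.
Proof.
rewrite /signless_laplacian linearD /= tr_diag_mx; congr (_ + _).
by apply/matrixP => i j; rewrite !mxE adj_sym.
Qed.

Lemma signless_laplacian_ge0 n (G : sgraph 'I_n) i j :
  0 <= signless_laplacian R G i j.
Proof. by rewrite !mxE addr_ge0 ?mulrn_wge0. Qed.

Lemma mul_signless_laplacian n (G : sgraph 'I_n) (x : 'rV[R]_n) i :
  (x *m signless_laplacian R G) 0 i =
  (deg G i)%:R * x 0 i + \sum_j (adj G i j)%:R * x 0 j.
Proof.
rewrite mulmxDr mul_mx_diag !mxE mulrC; congr (_ + _).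
by apply: eq_bigr => j _; rewrite !mxE adj_sym mulrC.
Qed.

Lemma qform_signless_laplacian n (G : sgraph 'I_n) (x : 'rV[R]_n) :
  qform (signless_laplacian R G) x =
  \sum_i \sum_j (adj G i j)%:R * (x 0 i ^+ 2 + x 0 i * x 0 j).
Proof.
rewrite /qform mxE; apply: eq_bigr => i _.
rewrite mul_signless_laplacian mxE mulrDl mulr_suml -sum_adj !mulr_suml.
by rewrite -big_split; apply: eq_bigr => j _ /=; ring.
Qed.

(** Termwise, [x_i ^ 2 + x_i x_j <= (3 x_i ^ 2 + x_j ^ 2) / 2]. By symmetry of adjacency, [x_i ^ 2]
    and [x_j ^ 2] have the same weighted sum [S], so the right-hand sides add up to [2 * S]. *)
Lemma qform_signless_laplacian_le n (G : sgraph 'I_n) (x : 'rV[R]_n) :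
  qform (signless_laplacian R G) x <= 2 * \sum_i (deg G i)%:R * x 0 i ^+ 2.
Proof.
set S := \sum_i _ * _.
have S1 : S = \sum_i \sum_j (adj G i j)%:R * x 0 i ^+ 2.
  by apply: eq_bigr => i _; rewrite -sum_adj mulr_suml.
have S2 : S = \sum_i \sum_j (adj G i j)%:R * x 0 j ^+ 2.
  rewrite S1 exchange_big; apply: eq_bigr => i _; apply: eq_bigr => j _ /=.
  by rewrite adj_sym.
have -> : 2 * S = \sum_i \sum_j (adj G i j)%:R *
    (2^-1 * (3 * x 0 i ^+ 2 + x 0 j ^+ 2)).
  transitivity (2^-1 * (3 * S + S)); first by field.
  rewrite {1}S1 S2 !mulr_sumr -big_split mulr_sumr; apply: eq_bigr => i _ /=.
  rewrite mulr_sumr -big_split mulr_sumr; apply: eq_bigr => j _ /=; ring.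
rewrite qform_signless_laplacian; apply: ler_sum => i _; apply: ler_sum => j _.
by apply: ler_wpM2l => //; have := sqr_ge0 (x 0 i - x 0 j); nra.
Qed.

Lemma deg_le n (G : sgraph 'I_n) i : (deg G i)%:R <= n%:R :> R.
Proof. by rewrite ler_nat -[leqRHS]card_ord max_card. Qed.

Lemma perron_q {n} (G : sgraph 'I_n.+1) :
  let q := max_q_eigenvalue R G in
  exists x : 'rV[R]_n.+1, [/\ forall i, 0 <= x 0 i, sqnorm x = 1,
    x *m signless_laplacian R G = q *: x
    & forall y, qform (signless_laplacian R G) y <= q * sqnorm y].
Proof.
apply: perron_frobenius_sym; first exact: signless_laplacian_tr.
exact: signless_laplacian_ge0.
Qed.

Lemma max_q_eigenvalue_qform {n} (G : sgraph 'I_n.+1) (x : 'rV[R]_n.+1) :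
  sqnorm x = 1 -> x *m signless_laplacian R G = max_q_eigenvalue R G *: x ->
  max_q_eigenvalue R G = qform (signless_laplacian R G) x.
Proof. by move=> x1 /qform_eigen ->; rewrite x1 mulr1. Qed.

Lemma max_q_eigenvalue_ge0 n (G : sgraph 'I_n.+1) : 0 <= max_q_eigenvalue R G.
Proof.
have [x [x0 x1 xq _]] := perron_q G.
rewrite (max_q_eigenvalue_qform _ _ x1 xq) qformE.
apply: sumr_ge0 => i _; apply: sumr_ge0 => j _.
by rewrite !mulr_ge0 // signless_laplacian_ge0.
Qed.

Lemma max_q_eigenvalue_le n (G : sgraph 'I_n.+1) :
  max_q_eigenvalue R G <= 2 * n.+1%:R.
Proof.
have [x [x0 x1 xq _]] := perron_q G.
rewrite (max_q_eigenvalue_qform _ _ x1 xq).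
apply: le_trans (qform_signless_laplacian_le _ _ _) _.
have -> : n.+1%:R = n.+1%:R * sqnorm x by rewrite x1 mulr1.
rewrite ler_pM2l // mulr_sumr; apply: ler_sum => i _.
by rewrite ler_wpM2r ?sqr_ge0 ?deg_le.
Qed.

Lemma edges_le_max_q_eigenvalue n (G : sgraph 'I_n.+1) :
  4 * #|edges G|%:R <= max_q_eigenvalue R G * n.+1%:R.
Proof.
have [x [_ _ _ /(_ (const_mx 1))]] := perron_q G.
have -> : sqnorm (const_mx 1 : 'rV[R]_n.+1) = n.+1%:R.
  rewrite /sqnorm (eq_bigr (fun=> 1)) => [|i _]; last by rewrite mxE expr1n.
  by rewrite sumr_const card_ord.
suff -> : qform (signless_laplacian R G) (const_mx 1) = 4 * #|edges G|%:R by [].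
transitivity (\sum_i 2 * (deg G i)%:R : R).
  rewrite qform_signless_laplacian; apply: eq_bigr => i _.
  by rewrite -sum_adj mulr_sumr; apply: eq_bigr => j _; rewrite !mxE; ring.
by rewrite -mulr_sumr -natr_sum sum_deg natrM; ring.
Qed.

(** Split each [x_i ^ 2] as [c] plus an excess, with [c = (1 - e) / n.+1]. The constant part of the
    degree sum gives the edge count; the excesses are nonnegative with total [e], and every degree
    is at most [n.+1]. *)
Lemma max_q_eigenvalue_le_edges n (G : sgraph 'I_n.+1) (e : R)
    (x : 'rV[R]_n.+1) :
  0 <= e -> sqnorm x = 1 ->
  x *m signless_laplacian R G = max_q_eigenvalue R G *: x ->
  (forall i, (1 - e) / n.+1%:R <= x 0 i ^+ 2) ->
  max_q_eigenvalue R G <= 4 * #|edges G|%:R / n.+1%:R + 2 * n.+1%:R * e.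
Proof.
move=> e0 x1 xq xe; set N : R := n.+1%:R; set m : R := #|edges G|%:R.
have N0 : 0 < N by rewrite ltr0n.
rewrite (max_q_eigenvalue_qform _ _ x1 xq).
apply: le_trans (qform_signless_laplacian_le _ _ _) _.
set c := (1 - e) / N in xe.
have -> : \sum_i (deg G i)%:R * x 0 i ^+ 2 =
    2 * m * c + \sum_i (deg G i)%:R * (x 0 i ^+ 2 - c).
  have -> : 2 * m = \sum_i (deg G i)%:R by rewrite -natr_sum sum_deg natrM.
  by rewrite mulr_suml -big_split; apply: eq_bigr => i _ /=; ring.
have le1 : \sum_i (deg G i)%:R * (x 0 i ^+ 2 - c) <= N * e.
  have -> : N * e = \sum_i N * (x 0 i ^+ 2 - c).
    rewrite -mulr_sumr sumrB -/(sqnorm x) x1 sumr_const card_ord.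
    by rewrite -[c *+ _]mulr_natr divfK ?gt_eqF //; ring.
  by apply: ler_sum => i _; rewrite ler_wpM2r ?subr_ge0 ?deg_le.
have le2 : m * c <= m / N.
  rewrite ler_wpM2l ?ler0n // /c ler_pdivrMr // mulVf ?gt_eqF //.
  by rewrite lerBlDr lerDl.
have -> : 4 * m / N = 4 * (m / N) by rewrite mulrA.
move: le1 le2; rewrite -mulrA.
move: (m / N) (m * c) (\sum_i _) => u v w; lra.
Qed.

(* By the eigenvalue equation at [k], with [t := x_k ^+ 2], the edges at [k]
   contribute [2 * q * t - deg k * t + \sum_(i adjacent to k) x_i ^+ 2] to [q];
   by minimality of [x_k] the last sum is at most [1 - (n.+2 - deg k) * t]. *)
Lemma max_q_eigenvalue_del_vertex n (G : sgraph 'I_n.+2) (x : 'rV[R]_n.+2) k :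
  (forall i, x 0 k ^+ 2 <= x 0 i ^+ 2) -> sqnorm x = 1 ->
  x *m signless_laplacian R G = max_q_eigenvalue R G *: x ->
  max_q_eigenvalue R G * (1 - 2 * x 0 k ^+ 2) - 1 + n.+2%:R * x 0 k ^+ 2 <=
  max_q_eigenvalue R (del_vertex G k) * (1 - x 0 k ^+ 2).
Proof.
move=> xk x1 xq; set q := max_q_eigenvalue R G in xq *.
set t := x 0 k ^+ 2 in xk *.
pose a i j : R := (adj G i j)%:R; set d : R := (deg G k)%:R.
pose y : 'rV[R]_n.+1 := \row_i x 0 (lift k i).
have [_ [_ _ _ /(_ y)]] := perron_q (del_vertex G k).
have -> : sqnorm y = 1 - t.
  move: x1; rewrite {1}/sqnorm (bigD1_ord k) //= -/t => <-.
  by rewrite addrAC subrr add0r; apply: eq_bigr => i _; rewrite mxE.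
apply: le_trans.
have akk : a k k = 0 by rewrite /a adj_irrefl.
have row_k : \sum_j a k j * x 0 j = (q - d) * x 0 k.
  have := mul_signless_laplacian _ G x k; rewrite xq mxE -/q -/d => E.
  by rewrite mulrBl E addrC addKr.
have qE : q = qform (signless_laplacian R G) x.
  exact: max_q_eigenvalue_qform.
(* The three summands are row [k] of the double sum, its column [k] outside that row, and the form
   of the remaining graph. *)
have splitk : q = q * t + (\sum_i a k i * x 0 i ^+ 2 + (q - d) * t) +
    qform (signless_laplacian R (del_vertex G k)) y.
  rewrite [LHS]qE qform_signless_laplacian (bigD1_ord k) //= -addrA.
  congr (_ + _).
    rewrite (eq_bigr (fun j => t * a k j + x 0 k * (a k j * x 0 j))) => [|j _].
      by rewrite big_split -!mulr_sumr /= row_k sum_adj -/d /t; ring.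
    by rewrite -/(a k j) -/t; ring.
  rewrite qform_signless_laplacian.
  have -> : \sum_i a k i * x 0 i ^+ 2 + (q - d) * t =
      \sum_i a (lift k i) k * (x 0 (lift k i) ^+ 2 + x 0 (lift k i) * x 0 k).
    have -> : (q - d) * t = \sum_j a k j * x 0 j * x 0 k.
      by rewrite -mulr_suml row_k /t; ring.
    rewrite -big_split (bigD1_ord k) //= akk !mul0r !add0r.
    by apply: eq_bigr => i _; rewrite /a adj_sym; ring.
  rewrite -big_split; apply: eq_bigr => i _; rewrite (bigD1_ord k) //=.
  congr (_ + _); apply: eq_bigr => j _.
  by rewrite !mxE adj_del_vertex.
have : 0 <= \sum_i (1 - a k i) * (x 0 i ^+ 2 - t).
  apply: sumr_ge0 => i _; rewrite mulr_ge0 ?subr_ge0 //.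
  by rewrite /a; case: (adj G k i).
have -> : \sum_i (1 - a k i) * (x 0 i ^+ 2 - t) =
    1 - n.+2%:R * t - \sum_i a k i * x 0 i ^+ 2 + d * t.
  rewrite -[X in X - _ - _]x1 /d -sum_adj mulr_suml.
  have -> : n.+2%:R * t = \sum_(i < n.+2) t.
    by rewrite sumr_const card_ord mulr_natl.
  rewrite /sqnorm -!sumrB -big_split; apply: eq_bigr => i _ /=.
  by rewrite -/(a k i); ring.
lra.
Qed.

(** This eliminates [t]. After multiplication by [1 - t > 0], the right side minus the left is at
    least [(q - p) * ((1 - e) - t * (p + 1 - e))], and both factors are nonnegative. *)
Lemma deletion_gain (p q q' t e : R) :
  0 < e -> 1 <= p -> p <= q -> 0 <= t -> t * (p + 1) <= 1 - e ->
  q * (1 - 2 * t) - 1 + (p + 1) * t <= q' * (1 - t) ->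
  q * (p - 1 + e) <= p * (q' + e).
Proof.
move=> e0 p1 pq t0 tp H.
have t1 : 0 < 1 - t by nra.
rewrite -subr_ge0 -(pmulr_lge0 _ t1).
have : 0 <= (q - p) * ((1 - e) - t * (p + 1 - e)).
  by apply: mulr_ge0; nra.
nra.
Qed.

End SignlessLaplacian.

(** * Extremal values and the limit for the edge count *)

Section ExtremalQuantities.

Local Open Scope classical_set_scope.

Context {R : realType} {U : finType}.
Variable F : sgraph U.

Lemma max_q_eigenvalue_le_ex_q n (G : sgraph 'I_n.+1) :
  free_of F G -> max_q_eigenvalue R G <= ex_q R F n.+1.
Proof.
move=> FG; apply: ub_le_sup; last by exists G.
by exists (2 * n.+1%:R) => _ [H _ <-]; exact: max_q_eigenvalue_le.
Qed.

Lemma ex_q_le n (b : R) : 0 <= b ->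
  (forall G : sgraph 'I_n, free_of F G -> max_q_eigenvalue R G <= b) ->
  ex_q R F n <= b.
Proof.
move=> b0 ub; rewrite /ex_q; set E := [set _ | _ in _].
(* If no graph on ['I_n] is F-free, the supremum is [0] by convention; this is where [0 <= b]
   enters. *)
have [->|/set0P ne] := eqVneq E set0; first by rewrite sup0.
by apply: ge_sup => // _ [G FG <-]; exact: ub.
Qed.

Lemma ex_q_ge0 n : 0 <= ex_q R F n.+1.
Proof.
have [[G FG]|nex] := pselect (exists G : sgraph 'I_n.+1, free_of F G).
  exact: le_trans (max_q_eigenvalue_ge0 _ G) (max_q_eigenvalue_le_ex_q _ _ FG).
rewrite /ex_q (_ : [set _ | G in _] = set0) ?sup0 //.
by rewrite -subset0 => y [G FG _]; apply: nex; exists G.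
Qed.

Lemma ex_edges_le_ex_q n :
  4 * (ex_edges F n.+1)%:R <= ex_q R F n.+1 * n.+1%:R.
Proof.
have [G FG|nex] := pickP (fun G : sgraph 'I_n.+1 => free_of F G); last first.
  by rewrite /ex_edges big_pred0 // mulr0 mulr_ge0 ?ex_q_ge0.
have [|H FH exH] := @eq_bigmax_cond _ (fun G : sgraph 'I_n.+1 => free_of F G)
    (fun G => #|edges G|).
  by apply/card_gt0P; exists G.
have -> : ex_edges F n.+1 = #|edges H| by rewrite -exH.
apply: le_trans (edges_le_max_q_eigenvalue _ H) _.
by rewrite ler_wpM2r // max_q_eigenvalue_le_ex_q.
Qed.

(* Either all entries of the Perron vector are about equal, so that [q] is
   close to the average value [4 m / n], or deleting a vertex with a small
   entry loses little. *)
Lemma ex_q_trichotomy n (e : R) : 0 < e -> e < 1 ->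
  [\/ ex_q R F n.+2 <= 4 * (ex_edges F n.+2)%:R / n.+2%:R + 2 * n.+2%:R * e,
      ex_q R F n.+2 <= n.+1%:R
    | ex_q R F n.+2 * (n%:R + e) <= n.+1%:R * (ex_q R F n.+1 + e)].
Proof.
move=> e0 e1; set A := _ + _; set B := n.+1%:R * _.
have ne0 : 0 < n%:R + e by rewrite ltr_wpDl.
(* Which alternative holds may depend on the graph, so each graph is bounded by the maximum of the
   three values before passing to the supremum. *)
suff : ex_q R F n.+2 <= Num.max (Num.max A n.+1%:R) (B / (n%:R + e)).
  rewrite !le_max => /orP[/orP[]|]; [exact: Or31|exact: Or32|].
  by rewrite ler_pdivlMr //; exact: Or33.
apply: ex_q_le => [|G FG]; first by rewrite !le_max ler0n orbT.
rewrite !le_max -orbA; have [x [x0 x1 xq _]] := @perron_q R _ G.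
have [k xk] : exists k, forall i, x 0 k ^+ 2 <= x 0 i ^+ 2.
  have [//|k _ xk] := @Order.TotalTheory.arg_minP _ R _ ord0 predT
    (fun i => x 0 i ^+ 2).
  by exists k => i; exact: xk.
have [kbig|ksmall] := lerP ((1 - e) / n.+2%:R) (x 0 k ^+ 2).
  apply/orP; left; apply: le_trans.
    apply: (max_q_eigenvalue_le_edges _ _ _ _ (ltW e0) x1 xq) => i.
    exact: le_trans kbig (xk i).
  rewrite lerD2r ler_wpM2r ?invr_ge0 // ler_pM2l // ler_nat.
  exact: card_edges_le_ex.
have [qsmall|qbig] := lerP (max_q_eigenvalue R G) n.+1%:R.
  by rewrite orbT.
apply/orP; right; apply/orP; right; rewrite ler_pdivlMr //.
have FGk : free_of F (del_vertex G k) by exact: free_of_pullback.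
apply: (@le_trans _ _ (n.+1%:R * (max_q_eigenvalue R (del_vertex G k) + e))).
  have -> : n%:R + e = n.+1%:R - 1 + e by rewrite -natr1 addrK.
  apply: (@deletion_gain _ _ _ _ (x 0 k ^+ 2)) => //.
  - by rewrite ler1n.
  - exact: ltW.
  - exact: sqr_ge0.
  - by rewrite natr1 -ler_pdivlMr // ltW.
  - by rewrite natr1; exact: max_q_eigenvalue_del_vertex.
by rewrite ler_pM2l ?ltr0n // lerD2r max_q_eigenvalue_le_ex_q.
Qed.

Lemma bin2R n : 'C(n.+2, 2)%:R = 2^-1 * n.+2%:R * n.+1%:R :> R.
Proof.
have /(congr1 (fun k => k%:R : R)) := mul_bin_diag n.+2 1.
rewrite bin1 !natrM /= => E.
by rewrite -mulrA E mulKf.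
Qed.

(** By averaging, the ratios to the binomial coefficients are nonincreasing, hence convergent.
    Passing to the square of the order costs the factor [1 - 1 / n.+2], which tends to [1]. *)
Lemma turan_density_cvg :
  4 * (ex_edges F n.+2)%:R / n.+2%:R ^+ 2 @[n --> \oo] -->
  2 * turan_density R F.
Proof.
pose t n : R := (ex_edges F n)%:R / 'C(n, 2)%:R.
have tcvg : cvgn (fun n => t n.+2).
  apply: nonincreasing_is_cvgn; last first.
    by exists 0 => _ [n _ <-]; rewrite /t divr_ge0.
  apply/nonincreasing_seqP => n; rewrite /t !bin2R.
  have := ex_edges_averaging _ F n; rewrite -(ler_nat R) !natrM => le.
  rewrite ler_pdivrMr ?mulr_gt0 ?invr_gt0 ?ltr0n // mulrAC.
  rewrite ler_pdivlMr ?mulr_gt0 ?invr_gt0 ?ltr0n //.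
  have n0 : 0 < n.+2%:R / 2 :> R by rewrite divr_gt0 ?ltr0n.
  have := ler_wpM2l (ltW n0) le; lra.
have tlim : t n.+2 @[n --> \oo] --> turan_density R F.
  move/cvg_ex: tcvg => [l tl]; suff -> : turan_density R F = l by [].
  apply: cvg_lim; first exact: Rhausdorff.
  by move: tl; rewrite (cvg_shiftS (fun n => t n.+1)) cvg_shiftS.
have h1 : 1 - harmonic n.+1 @[n --> \oo] --> (1 - 0 : R).
  apply: cvgB; first exact: cvg_cst.
  by rewrite (cvg_shiftS (@harmonic R)); exact: cvg_harmonic.
rewrite (_ : (fun n => _) = fun n => 2 * t n.+2 * (1 - harmonic n.+1)).
  rewrite -[2 * turan_density R F]mulr1 -[X in _ * X]subr0.
  by apply: cvgM h1; apply: cvgM tlim; exact: cvg_cst.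
apply/funext => n; rewrite /t /harmonic /= bin2R.
by rewrite -(natr1 n.+1); field; rewrite ?nat1r ?natr1 !pnatr_eq0.
Qed.

End ExtremalQuantities.

(** * Divergence of the harmonic series against convergence *)

Section Limits.

Local Open Scope classical_set_scope.

Context {R : realType}.

(** Each of the [m.+1] steps from [m] to [m + m.+1] drops by at least [d / (2 * m.+1)], so [r] loses
    [d / 2] in total. Yet both end values lie within [d / 4] of [l], strictly. *)
Lemma cvgn_no_harmonic_decrease (r : nat -> R) (l d : R) (M : nat) :
  r @ \oo --> l -> 0 < d ->
  ~ (forall n, (M <= n)%N -> d <= n.+1%:R * (r n - r n.+1)).
Proof.
move=> rl d0 dec.
have d4 : 0 < d / 4 by lra.
have [M' _ close] : \forall n \near \oo, `|l - r n| < d / 4.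
  by move/cvgrPdist_lt: rl => /(_ _ d4).
pose m := maxn M M'; pose D := 2 * m.+1%:R : R.
have D0 : 0 < D by rewrite mulr_gt0 // ltr0n.
have drop k : (k <= m.+1)%N -> k%:R * (d / D) <= r m - r (m + k)%N.
  elim: k => [|k IH] km; first by rewrite mul0r addn0 subrr.
  rewrite addnS -natr1 mulrDl mul1r.
  have := IH (ltnW km); have := dec (m + k)%N.
  rewrite (leq_trans (leq_maxl M M')) ?leq_addr // => /(_ isT) dk.
  suff : d / D <= r (m + k)%N - r (m + k).+1 by lra.
  rewrite ler_pdivrMr // (le_trans dk) // mulrC ler_wpM2l //.
    by rewrite -(@pmulr_rge0 _ (m + k).+1%:R) ?ltr0n // (le_trans _ dk) // ltW.
  by rewrite /D -natrM ler_nat mul2n -addnn addSn ltnS leq_add2l ltnW.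
have := drop m.+1 (leqnn _).
have -> : m.+1%:R * (d / D) = d / 2.
  by rewrite /D; field; rewrite ?pnatr_eq0.
have := close m (leq_maxr _ _).
have := close (m + m.+1)%N (leq_trans (leq_maxr _ _) (leq_addr _ _)).
rewrite !ltr_norml => /andP[? ?] /andP[? ?]; lra.
Qed.

End Limits.

(** * Comparison of the two densities *)

Theorem theorem2p3 (R : realType) (U : finType) (F : sgraph U) :
  (3 <= chi F)%N ->
  1 < q_density R F ->
  q_density R F = 2 * turan_density R F.
Proof.
move=> _ L1; set L := q_density R F in L1 *.
pose s n : R := ex_q R F n / n%:R.
pose u n : R := 4 * (ex_edges F n.+2)%:R / n.+2%:R ^+ 2.
(* The limit of a divergent sequence defaults to [0], so [1 < L] already forces convergence. *)
have scvg : cvgn s.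
  apply: contrapT => /dvgP L0; move: L1.
  by rewrite /L /q_density -/s L0 ltNge ler01.
have sL : (s n.+2 @[n --> \oo] --> L)%classic.
  by rewrite (cvg_shiftS (fun n => s n.+1)) cvg_shiftS.
have uL : (u n @[n --> \oo] --> 2 * turan_density R F)%classic.
  exact: turan_density_cvg.
have us n : u n <= s n.+2.
  rewrite /u /s ler_pdivrMr ?exprn_gt0 ?ltr0n // expr2 mulrA divfK ?pnatr_eq0 //.
  exact: ex_edges_le_ex_q.
apply/le_anti/andP; split; last first.
  by apply: (ler_cvg_to uL sL); exact: nearW.
rewrite leNgt; apply/negP => ltL; set P := 2 * _ in uL ltL.
(* The bound [2 * e < L - P] rules out the first alternative of [ex_q_trichotomy] for large
   orders. *)
have [e [e0 e1 eL]] : exists e : R, [/\ 0 < e, e < 1 & 2 * e < L - P].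
  exists (Num.min (1 / 2) ((L - P) / 4)).
  rewrite lt_min gt_min; split; [apply/andP; split; lra|apply/orP; left; lra|].
  have : Num.min (1 / 2) ((L - P) / 4) <= (L - P) / 4.
    by rewrite ge_min lexx orbT.
  lra.
(* A threshold strictly between [1] and [L]: it excludes the second alternative and keeps the
   decrease of [r] uniform. *)
pose c := (1 + L) / 2.
have [M _ far] :
    (\forall n \near \oo, u n + 2 * e < s n.+2 /\ c < s n.+2)%classic.
  near=> n; split.
    rewrite addrC -ltrBrDr; near: n.
    by apply: (cvgr_gt (L - P)) => //; exact: cvgB.
  near: n; apply: (cvgr_gt L) => //; rewrite /c; lra.
(* Dividing by the order minus one makes the factor [n.+2] cancel in the third alternative below. *)
pose r n : R := ex_q R F n.+2 / n.+1%:R.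
have rL : (r n @[n --> \oo] --> L)%classic.
  have h1 : (1 + harmonic n @[n --> \oo] --> (1 + 0 : R))%classic.
    by apply: cvgD; [exact: cvg_cst|exact: cvg_harmonic].
  rewrite (_ : r = fun n => s n.+2 * (1 + harmonic n)).
    by rewrite -[L]mulr1 -[X in _ * X]addr0; exact: cvgM h1.
  apply/funext => n; rewrite /r /s /harmonic /=.
  by rewrite -(natr1 n.+1); field; rewrite ?nat1r ?natr1 !pnatr_eq0.
have d0 : 0 < e * (c - 1) by apply: mulr_gt0 => //; rewrite /c; lra.
apply: (cvgn_no_harmonic_decrease _ _ _ M rL d0) => n Mn.
have [|un cn] := far n.+1; first exact: leqW.
have N0 : 0 < n.+3%:R :> R by rewrite ltr0n.
have n2 : 0 < n.+2%:R :> R by rewrite ltr0n.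
have n1 : 0 < n.+1%:R :> R by rewrite ltr0n.
have exE : ex_q R F n.+3 = r n.+1 * n.+2%:R by rewrite divfK ?gt_eqF.
have exE' : ex_q R F n.+2 = r n * n.+1%:R by rewrite divfK ?gt_eqF.
have exS : ex_q R F n.+3 = s n.+3 * n.+3%:R by rewrite divfK ?gt_eqF.
have c1 : 1 < c by rewrite /c; lra.
have sr : s n.+3 <= r n.+1.
  rewrite /s /r ler_wpM2l ?ex_q_ge0 // lef_pV2 ?posrE // ler_nat //.
have [] := ex_q_trichotomy F n.+1 e e0 e1.
- move=> le; have : s n.+3 <= u n.+1 + 2 * e.
    rewrite /s ler_pdivrMr //; apply: le_trans le _; rewrite /u.
    rewrite le_eqVlt; apply/orP; left; apply/eqP.
    by move: N0; move: (n.+3%:R : R) => N N0; field; exact: lt0r_neq0.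
  lra.
- rewrite exE -ler_pdivlMr // divff ?gt_eqF //; lra.
(* After cancelling [n.+2], the third alternative reads [e * (r n.+1 - 1) <= n.+1 * (r n - r n.+1)],
   and [r n.+1 > c]. *)
- rewrite exE exE' [r n.+1 * _]mulrC -mulrA ler_pM2l //; nra.
Unshelve. all: by end_near. Qed.
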